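(* If $T$ is a tree that is not a path, then $T$ has a standard $1$-associate $T'$ such that $M_T>M_{T'}$.
   Context: A subtree of a tree $T$ is a nonempty connected subgraph; the order of a graph is its number of vertices. The mean subtree order $M_T$ is the average of the orders of all subtrees of $T$. Let $T$ be a tree that is not a path. Let $w$ be a leaf of $T$, let $v$ be the vertex of degree at least $3$ in $T$ that is closest to $w$, and let $u$ be a neighbour of $v$ that is not on the shortest $w$--$v$ path. The tree obtained from $T$ by deleting the edge $vu$ and adding the edge $uw$ is called a standard $1$-associate of $T$. (Different choices of $w$ and $u$ may give different standard $1$-associates.) *)

(* Defs.v *)
From HB Require Import structures.
From mathcomp Require Import all_boot all_order all_algebra.
Set Implicit Arguments.
Unset Strict Implicit.
Unset Printing Implicit Defensive.

Import Order.TTheory GRing.Theory Num.Theory.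

(* A graph on the vertex set V is given by its adjacency relation e : rel V. *)

Definition simple_graph (V : finType) (e : rel V) : Prop :=
  symmetric e /\ irreflexive e.

Definition connected_graph (V : finType) (e : rel V) : Prop :=
  0 < #|V| /\ forall x y : V, connect e x y.

(* A sequence x :: y :: nil is a ucycle whenever x and y are adjacent, hence
   the bound on the size. *)
Definition acyclic_graph (V : finType) (e : rel V) : Prop :=
  forall c : seq V, 2 < size c -> ~ ucycle e c.

Definition is_tree (V : finType) (e : rel V) : Prop :=
  [/\ simple_graph e, connected_graph e & acyclic_graph e].

Definition is_path_graph (V : finType) (e : rel V) : Prop :=
  exists f : 'I_#|V| -> V, bijective f /\
    forall i j : 'I_#|V|, e (f i) (f j) = (i.+1 == j) || (j.+1 == i).

Definition deg (V : finType) (e : rel V) (x : V) : nat := #|[set y | e x y]|.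

(* Equals #|V| when there is no walk from x to y; otherwise a shortest walk
   has length less than #|V|. *)
Definition dist (V : finType) (e : rel V) (x y : V) : nat :=
  find (fun n => [exists p : n.-tuple V, path e x p && (last x p == y)])
       (iota 0 #|V|).

(* As usual for path, the initial vertex x is not listed in p. *)
Definition shortest_path (V : finType) (e : rel V) (x y : V) (p : seq V) : bool :=
  [&& path e x p, last x p == y & size p == dist e x y].

Definition edges (V : finType) (e : rel V) : {set {set V}} :=
  [set [set p.1; p.2] | p : V * V & e p.1 p.2].

(* A pair (vertices, edges), not necessarily induced. *)
Definition is_subgraph (V : finType) (e : rel V)
    (H : {set V} * {set {set V}}) : bool :=
  (H.2 \subset edges e) && (cover H.2 \subset H.1).

Definition connected_subgraph (V : finType)
    (H : {set V} * {set {set V}}) : bool :=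
  [forall x in H.1, forall y in H.1,
     connect (fun a b => [set a; b] \in H.2) x y].

Definition subtrees (V : finType) (e : rel V) :
    {set {set V} * {set {set V}}} :=
  [set H | [&& is_subgraph e H, H.1 != set0 & connected_subgraph H]].

Definition mean_subtree_order (V : finType) (e : rel V) : rat :=
  ((\sum_(H in subtrees e) #|H.1|)%:R / #|subtrees e|%:R)%R.

(* Delete the edge vu and add the edge uw. *)
Definition move_edge (V : finType) (e : rel V) (v u w : V) : rel V :=
  fun x y => (e x y && ([set x; y] != [set v; u])) || ([set x; y] == [set u; w]).

Definition standard_1_associate (V : finType) (e e' : rel V) : Prop :=
  exists w v u : V,
    [/\ deg e w = 1,
        3 <= deg e v /\ (forall x, 3 <= deg e x -> dist e w v <= dist e w x),
        e v u /\ (forall p, shortest_path e w v p -> u \notin w :: p)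
      & e' =2 move_edge e v u w].

(* Main.v *)
Require Import Defs.
From HB Require Import structures.
From mathcomp Require Import all_boot all_order all_algebra.
From mathcomp Require Import zify ring lra.
Set Implicit Arguments.
Unset Strict Implicit.
Unset Printing Implicit Defensive.
Import Order.TTheory GRing.Theory Num.Theory.

(** A tree that is not a path has a vertex [v] of degree at least 3 carrying two
    pendant paths [a :: s] and [b :: t]: take a path of the tree that starts at
    a vertex of degree at least 3 and is longest with this property, and let [v]
    be its start.  Any neighbour of [v] off this path opens a branch without
    such vertices (another one there would start a longer path), so that
    branch is a path hanging at [v], and there are two such neighbours
    ([exists_fork]).  Let [l] be the last vertex of [a :: s].  Its nearest
    branching vertex is [v], and moving the edge [vb] to [lb] straightens the
    two pendant paths into a single one ([fork_standard_associate]).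

    It remains to see that this lowers the mean.  Let [Q] be the tree without
    the two pendant paths, rooted at [v], with [n] subtrees through [v] of total
    order [w] and [n'] other subtrees of total order [w'].  Let [A] and [B] be
    the numbers of vertices of the pendant paths and [C = A + B].  Then the
    number and the total order of all subtrees have the form
    [N0 + (n - 1) * f] and [W0 + K * f], where
        [N0 = n' + (C + 1) * (C + 2) / 2],
        [W0 = w' + (C + 1) * (C + 2) * (C + 3) / 6],
        [K = w - n + (n - 1) * (C + 2) / 2]
    are the same for both trees and only [f] changes: it counts the subtrees
    through [v] that consist of [v] and vertices of the two paths, so
    [f = (A + 1) * (B + 1)] for the original tree and [f = A + B + 1], smaller
    by [A * B], for its associate.
    The mean increases with [f] because [W0 * (n - 1) < K * N0]
    ([core_profile_ineq]).  That inequality has two halves: subpaths are short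
    on average, which is a computation, and the subtrees of [Q] avoiding [v] are
    on average not larger than those through [v].  The second half is a theorem
    of Jamison, obtained by induction on [Q] cut along an edge at the root
    ([tree_balanced]).

    All the counting goes through one decomposition.  In an acyclic graph a
    subtree is the same thing as a connected vertex set ([subtreesE]), and when
    two parts are linked by a single edge, the four numbers of the whole are
    polynomials in those of the parts ([profile_join]).  The original tree, its
    associate, the paths and the cuts of [Q] are all instances. *)

(** * Connected vertex sets *)

(** Connectivity is phrased by cuts: every nonempty proper part of [S] is left by
    an edge inside [S].  In this form it restricts to and glues from the two
    sides of a bridge without any surgery on walks. *)
Definition connected_in (V : finType) (e : rel V) (S : {set V}) : bool :=
  (S != set0) && [forall R : {set V}, (R != set0) && (R \proper S) ==>
    [exists x in R, exists y in S :\: R, e x y]].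

Lemma connected_inP (V : finType) (e : rel V) (S : {set V}) :
  reflect (S != set0 /\ forall R : {set V}, R != set0 -> R \proper S ->
             exists x y, [/\ x \in R, y \in S, y \notin R & e x y])
          (connected_in e S).
Proof.
apply: (iffP andP) => -[S0 cutS]; split=> //.
  move=> R R0 RS; have /forallP/(_ R) := cutS; rewrite R0 RS /=.
  case/exists_inP=> x xR /exists_inP[y]; rewrite inE => /andP[yR yS] exy.
  by exists x, y.
apply/forallP=> R; apply/implyP=> /andP[R0 RS].
have [x [y [xR yS yR exy]]] := cutS R R0 RS.
apply/exists_inP; exists x => //; apply/exists_inP; exists y => //.
by rewrite inE yR.
Qed.

Lemma connected_in1 (V : finType) (e : rel V) (v : V) :
  connected_in e [set v].
Proof.
apply/connected_inP; split=> [|R R0]; first by apply/set0Pn; exists v; rewrite inE.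
by rewrite properEneq subset1 => /andP[Rv]; rewrite (negPf Rv) (negPf R0).
Qed.

Lemma eq_connected_in (V : finType) (e e' : rel V) (S : {set V}) :
  {in S &, e =2 e'} -> connected_in e S = connected_in e' S.
Proof.
move=> ee'; rewrite /connected_in; congr andb; apply: eq_forallb => R.
have [|] := boolP ((R != set0) && (R \proper S)); rewrite ?implybF //= => /andP[_ /proper_sub/subsetP RS].
apply: eq_existsb => x; case xR: (x \in R) => //=.
apply: eq_existsb => y; case: (boolP (y \in _ :\: _)) => //=.
rewrite inE => /andP[_ yS]; rewrite ee' //; exact: RS.
Qed.

(** The edge [v y] is a bridge between the two parts.  They play different roles
    because [v] is also to be the root of the union. *)
Definition bridged (V : finType) (e : rel V) (X2 : {set V}) (v : V)
    (X1 : {set V}) (y : V) : Prop :=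
  [/\ v \in X2, y \in X1, [disjoint X1 & X2], e v y &
      forall x z, x \in X2 -> z \in X1 -> e x z -> x = v /\ z = y].

(** A cut that splits neither [S1] nor [S2] has one of them on each side, and is
    then crossed by the edge [v y]. *)
Lemma connected_in_join (V : finType) (e : rel V) (S1 S2 : {set V}) (v y : V) :
  symmetric e -> v \in S2 -> y \in S1 -> e v y ->
  connected_in e S1 -> connected_in e S2 -> connected_in e (S1 :|: S2).
Proof.
move=> esym vS2 yS1 evy /connected_inP[S10 cut1] /connected_inP[S20 cut2].
apply/connected_inP; split=> [|R R0 RS].
  by apply/set0Pn; exists y; rewrite inE yS1.
have cut (S : {set V}) : S \subset S1 :|: S2 ->
    (forall R : {set V}, R != set0 -> R \proper S ->
             exists x y, [/\ x \in R, y \in S, y \notin R & e x y]) ->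
    ~~ (S \subset R) -> R :&: S != set0 ->
    exists x y, [/\ x \in R, y \in S1 :|: S2, y \notin R & e x y].
  move=> SS cutS nSR RS0; have [||x [z [xR zS zR exz]]] := cutS (R :&: S) => //.
    by rewrite properE subsetIr subsetI subxx andbT.
  move: xR zR; rewrite !inE zS andbT => /andP[xR _] zR.
  by exists x, z; split=> //; apply: (subsetP SS).
have [S1R|nS1R] := boolP (S1 \subset R); last first.
  have [RS10|] := eqVneq (R :&: S1) set0; last by apply: cut nS1R => //; apply: subsetUl.
  have [S2R|nS2R] := boolP (S2 \subset R).
    exists v, y; split=> //; first exact: (subsetP S2R).
      by rewrite inE yS1.
    by apply/negP=> yR; have := in_set0 y; rewrite -RS10 inE yR yS1.
  apply: cut nS2R _ => //; first exact: subsetUr.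
  case/set0Pn: R0 => x xR; apply/set0Pn; exists x; rewrite inE xR /=.
  have := subsetP (proper_sub RS) x xR; rewrite inE => /orP[] // xS1.
  by have := in_set0 x; rewrite -RS10 inE xR xS1.
have nS2R : ~~ (S2 \subset R).
  by apply/negP=> S2R; move: RS; rewrite properE subUset S1R S2R andbF.
have [RS20|] := eqVneq (R :&: S2) set0; last by apply: cut nS2R => //; apply: subsetUr.
exists y, v; split=> //; first exact: (subsetP S1R).
- by rewrite inE vS2 orbT.
- by apply/negP=> vR; have := in_set0 v; rewrite -RS20 inE vR vS2.
by rewrite esym.
Qed.

Lemma bridged_sym (V : finType) (e : rel V) (X1 X2 : {set V}) (v y : V) :
  symmetric e -> bridged e X2 v X1 y -> bridged e X1 y X2 v.
Proof.
move=> esym [vX2 yX1 dX evy cross]; split; rewrite // 1?disjoint_sym 1?esym //.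
by move=> x z xX1 zX2; rewrite esym => /(cross _ _ zX2 xX1)[-> ->].
Qed.

(** A cut of [S :&: X2] becomes a cut of [S] by putting the part of [S] in [X1] on
    the side of [v].  The edge that leaves it cannot be the bridge, so it lies in
    [X2]. *)
Lemma connected_in_split (V : finType) (e : rel V) (X1 X2 S : {set V}) (v y : V) :
  symmetric e -> bridged e X2 v X1 y -> S \subset X2 :|: X1 ->
  connected_in e S -> S :&: X2 != set0 -> S :&: X1 != set0 ->
  v \in S /\ connected_in e (S :&: X2).
Proof.
move=> esym [vX2 yX1 dX evy cross] SX /connected_inP[S0 cut] S20 S10.
have X21 x : x \in X2 -> x \in X1 = false by move=> xX2; apply: disjointFl dX xX2.
have inX x : x \in S -> (x \in X2) || (x \in X1) by move=> /(subsetP SX); rewrite inE.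
have vS : v \in S.
  have [|x [z []]] := cut (S :&: X2) S20.
    rewrite properE subsetIl subsetI subxx /=.
    apply: contra S10 => SX2; apply/eqP/setP=> x; rewrite !inE.
    by apply/negP=> /andP[xS]; rewrite X21 // (subsetP SX2).
  rewrite !inE => /andP[xS xX2] zS; rewrite zS /= => zX2 exz.
  have zX1 : z \in X1 by move: (inX _ zS); rewrite (negPf zX2).
  by have [<- _] := cross _ _ xX2 zX1 exz.
split=> //; apply/connected_inP; split=> // R R0 /properP[/subsetP RS [t]].
rewrite inE => /andP[tS tX2] tR.
have [vR|vR] := boolP (v \in R).
  have [||x [z [xR zS zR exz]]] := cut (R :|: S :&: X1).
  - by apply/set0Pn; exists v; rewrite inE vR.
  - apply/properP; split; last by exists t; rewrite // !inE (negPf tR) X21 ?andbF.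
    by rewrite subUset subsetIl andbT; apply/subsetP=> x /RS; rewrite inE => /andP[].
  move: zR xR; rewrite !inE negb_or zS /= => /andP[zR zX1].
  have zX2 : z \in X2 by move: (inX _ zS); rewrite (negPf zX1) orbF.
  case/orP=> [xR|/andP[xS xX1]]; first by exists x, z; rewrite inE zS.
  by rewrite esym in exz; have [zv _] := cross _ _ zX2 xX1 exz; rewrite zv vR in zR.
have [|x [z [xR zS zR exz]]] := cut R R0.
  apply/properP; split; last by exists t.
  by apply/subsetP=> x /RS; rewrite inE => /andP[].
exists x, z; split=> //; rewrite inE zS /=.
have := inX _ zS; case/orP=> // zX1; have /RS := xR; rewrite inE => /andP[xS xX2].
by have [xv _] := cross _ _ xX2 zX1 exz; rewrite -xv xR in vR.
Qed.

(** * Counting connected sets across a bridge *)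

Definition rooted_csets (V : finType) (e : rel V) (X : {set V}) (v : V) :
    {set {set V}} :=
  [set S : {set V} | [&& S \subset X, connected_in e S & v \in S]].

Definition unrooted_csets (V : finType) (e : rel V) (X : {set V}) (v : V) :
    {set {set V}} :=
  [set S : {set V} | [&& S \subset X, connected_in e S & v \notin S]].

(** A connected set through [v] is a connected set of [X2] through [v], alone or
    together with a connected set of [X1] through [y].  The weight [F] is kept
    arbitrary so that the same bijection serves to count the sets and to add up
    their orders. *)
Lemma sum_rooted_join (V : finType) (e : rel V) (X1 X2 : {set V}) (v y : V)
    (F : {set V} -> nat) : symmetric e -> bridged e X2 v X1 y ->
  \sum_(S in rooted_csets e (X2 :|: X1) v) F S =
  \sum_(S2 in rooted_csets e X2 v)
     (F S2 + \sum_(S1 in rooted_csets e X1 y) F (S2 :|: S1)).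
Proof.
move=> esym br; have [vX2 yX1 dX evy cross] := br.
have n0 : set0 \notin rooted_csets e X1 y by rewrite !inE !andbF.
(* The empty set stands for a connected set that stays in [X2]. *)
transitivity (\sum_(S2 in rooted_csets e X2 v)
    \sum_(S1 in set0 |: rooted_csets e X1 y) F (S2 :|: S1)); last first.
  by apply: eq_bigr => S2 _; rewrite big_setU1 //= setU0.
rewrite pair_big_dep /=.
rewrite (reindex_onto (fun p : {set V} * {set V} => p.1 :|: p.2)
   (fun S => (S :&: X2, S :&: X1))) => /= [|S]; last first.
  by rewrite inE => /and3P[/setIidPl SX _ _]; rewrite -setIUr.
apply: eq_bigl => -[S2 S1] /=; rewrite !inE xpair_eqE.
apply/idP/idP.
  case/and3P=> /and3P[SX SC vS] /eqP eS2 /eqP eS1.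
  have S2n0 : (S2 :|: S1) :&: X2 != set0.
    by apply/set0Pn; exists v; rewrite !inE vS.
  have [S10|S10] := eqVneq S1 set0.
    move: eS2 SC vS; rewrite S10 setU0 inE orbF => eS2 -> ->; rewrite !andbT.
    by rewrite -eS2; apply: subsetIr.
  rewrite -{1}eS1 in S10.
  have [_] := connected_in_split esym br SX SC S2n0 S10.
  rewrite [X2 :|: X1]setUC in SX; have [] := connected_in_split esym (bridged_sym esym br) SX SC S10 S2n0.
  rewrite eS1 eS2 => yS -> ->.
  have vS2 : v \in S2 by rewrite -eS2 !inE vS.
  have yS1 : y \in S1 by rewrite -eS1 in_setI yS.
  by rewrite vS2 yS1 -{1}eS2 -eS1 !subsetIr orbT.
case/andP=> /and3P[S2X S2C vS2].
have S1X2 (S : {set V}) : S \subset X1 -> S :&: X2 = set0.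
  by move=> SX; apply/eqP; rewrite setI_eq0 (disjointWl SX).
have S2X1 : S2 :&: X1 = set0.
  by apply/eqP; rewrite setI_eq0 disjoint_sym (disjointWr S2X).
rewrite !setIUl (setIidPl S2X) S2X1 vS2 andbT set0U.
case/orP=> [/eqP->|/and3P[S1X S1C yS1]].
  by rewrite !setU0 !set0I setU0 S2C !eqxx !andbT subsetU ?S2X.
rewrite S1X2 // (setIidPl S1X) setU0 !eqxx !andbT setUSS //=.
by rewrite setUC (connected_in_join esym vS2 yS1).
Qed.

(** A connected set that avoids [v] cannot use the bridge, so it stays on one
    side. *)
Lemma sum_unrooted_join (V : finType) (e : rel V) (X1 X2 : {set V}) (v y : V)
    (F : {set V} -> nat) : symmetric e -> bridged e X2 v X1 y ->
  \sum_(S in unrooted_csets e (X2 :|: X1) v) F S =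
  \sum_(S in unrooted_csets e X2 v) F S +
  (\sum_(S in rooted_csets e X1 y) F S + \sum_(S in unrooted_csets e X1 y) F S).
Proof.
move=> esym br; have [vX2 yX1 dX evy cross] := br.
have X12 x : x \in X1 -> x \in X2 = false by move=> xX2; apply: disjointFr dX xX2.
rewrite (bigID (fun S : {set V} => S \subset X2)) /=; congr (_ + _).
  apply: eq_bigl => S; rewrite !inE; apply/idP/idP.
    by case/andP=> /and3P[_ -> ->] ->.
  by case/and3P=> SX -> ->; rewrite SX subsetU ?SX.
rewrite [LHS](bigID (fun S : {set V} => y \in S)) /=.
have key (S : {set V}) : [&& S \subset X2 :|: X1, connected_in e S & v \notin S]
    && ~~ (S \subset X2) = (S \subset X1) && connected_in e S.
  apply/idP/idP.
    case/andP=> /and3P[SX SC vS] nSX2; rewrite SC andbT.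
    have [S20|S20] := eqVneq (S :&: X2) set0.
      apply/subsetP=> x xS; have := subsetP SX x xS; rewrite inE => /orP[] // xX2.
      by have := in_set0 x; rewrite -S20 inE xS xX2.
    have S10 : S :&: X1 != set0.
      have /subsetPn[x xS xX2] := nSX2; apply/set0Pn; exists x.
      by move: (subsetP SX x xS); rewrite !inE xS (negPf xX2).
    by have [vS'] := connected_in_split esym br SX SC S20 S10; rewrite vS' in vS.
  case/andP=> SX SC; rewrite SC subsetU ?SX ?orbT //=.
  apply/andP; split; first by apply/negP=> /(subsetP SX) /X12; rewrite vX2.
  have /connected_inP[/set0Pn[x xS] _] := SC.
  by apply/subsetPn; exists x; rewrite // X12 // (subsetP SX).
by congr (_ + _); apply: eq_bigl => S; rewrite !inE key andbA.
Qed.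

(** Number and total order of the connected sets through the root ([nroot],
    [wroot]) and of those avoiding it ([nrest], [wrest]). *)
Record profile := Profile { nroot : nat; wroot : nat; nrest : nat; wrest : nat }.

Definition profile_of (V : finType) (e : rel V) (X : {set V}) (v : V) : profile :=
  Profile #|rooted_csets e X v| (\sum_(S in rooted_csets e X v) #|S|)
    #|unrooted_csets e X v| (\sum_(S in unrooted_csets e X v) #|S|).

Definition join_profile (q2 q1 : profile) : profile :=
  let: Profile n2 w2 n2' w2' := q2 in let: Profile n1 w1 n1' w1' := q1 in
  Profile (n2 * n1.+1) (w2 * n1.+1 + n2 * w1) (n2' + (n1 + n1')) (w2' + (w1 + w1')).

Definition point_profile : profile := Profile 1 1 0 0.

Lemma profile_join (V : finType) (e : rel V) (X1 X2 : {set V}) (v y : V) :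
  symmetric e -> bridged e X2 v X1 y ->
  profile_of e (X2 :|: X1) v = join_profile (profile_of e X2 v) (profile_of e X1 y).
Proof.
move=> esym br; have [_ _ dX _ _] := br.
rewrite /profile_of /join_profile -!sum1_card !(sum_rooted_join _ esym br).
rewrite !(sum_unrooted_join _ esym br); congr Profile.
  by rewrite big_distrl /=; apply: eq_bigr => S _; rewrite sum1_card mul1n add1n.
rewrite !big_distrl -big_split /=; apply: eq_bigr => S2.
rewrite inE mul1n mulnS -addnA => /and3P[S2X _ _]; congr (_ + _).
rewrite big_distrr -big_split /=; apply: eq_bigr => S1.
rewrite inE muln1 => /and3P[S1X _ _]; rewrite cardsU.
suff -> : S2 :&: S1 = set0 by rewrite cards0 subn0.
by apply/eqP; rewrite setI_eq0 disjoint_sym (disjointW S1X S2X).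
Qed.

Lemma profile_point (V : finType) (e : rel V) (v : V) :
  profile_of e [set v] v = point_profile.
Proof.
have -> : profile_of e [set v] v = Profile #|[set [set v]]|
    (\sum_(S in [set [set v]]) #|S|) #|@set0 {set V}| (\sum_(S in @set0 {set V}) #|S|).
  rewrite /profile_of; have -> : rooted_csets e [set v] v = [set [set v]].
    apply/setP=> S; rewrite !inE subset1.
    by have [->|_] := eqVneq S [set v]; [rewrite connected_in1 inE eqxx|case: eqVneq => //= ->; rewrite inE andbF].
  have -> // : unrooted_csets e [set v] v = set0.
  apply/setP=> S; rewrite !inE subset1.
  have [->|_] := eqVneq S [set v]; first by rewrite inE eqxx !andbF.
  by have [->|//] := eqVneq S set0; rewrite /connected_in eqxx.
by rewrite !cards1 cards0 big_set1 big_set0 cards1.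
Qed.

Lemma eq_profile (V : finType) (e e' : rel V) (X : {set V}) (v : V) :
  {in X &, e =2 e'} -> profile_of e X v = profile_of e' X v.
Proof.
move=> ee'; have eqc (S : {set V}) : S \subset X -> connected_in e S = connected_in e' S.
  by move/subsetP=> SX; apply: eq_connected_in => x y /SX xX /SX; apply: ee'.
rewrite /profile_of; have -> : rooted_csets e X v = rooted_csets e' X v.
  by apply/setP=> S; rewrite !inE; case: (boolP (S \subset X)) => //= /eqc ->.
suff -> : unrooted_csets e X v = unrooted_csets e' X v by [].
by apply/setP=> S; rewrite !inE; case: (boolP (S \subset X)) => //= /eqc ->.
Qed.

(** * Balanced profiles and the comparison of means *)

(** The last clause compares averages: sets avoiding the root are on average not
    larger than sets through it.  The others are what its inductive proof and the final
    comparison consume: only one connected set through the root has order 1, and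
    no connected set has more vertices than there are sets through the root. *)
Definition balanced (q : profile) : Prop :=
  [/\ 0 < nroot q, (nroot q).*2 <= (wroot q).+1, wroot q <= nroot q * nroot q
    & wrest q * nroot q <= wroot q * nrest q].

Lemma balanced_point : balanced point_profile.
Proof. by []. Qed.

(** For the last clause, the sets avoiding the root split into those of [q2],
    handled by the hypothesis on [q2], and all sets of [q1].  On average the
    latter are not larger than [w1 / n1], whereas the sets through the new root
    have average order [w2 / n2 + w1 / (n1 + 1)].  Since [1 <= w2 / n2], it is
    enough that [w1 / n1 - w1 / (n1 + 1) = w1 / (n1 * (n1 + 1))] is at most 1,
    and this follows from [w1 <= n1 * n1]. *)
Lemma balanced_join (q2 q1 : profile) :
  balanced q2 -> balanced q1 -> balanced (join_profile q2 q1).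
Proof.
case: q2 => n2 w2 n2' w2'; case: q1 => n1 w1 n1' w1'; rewrite /balanced /=.
move=> [n2gt0 lo2 up2 mean2] [n1gt0 lo1 up1 mean1].
have le_nw2 : n2 <= w2 by lia.
have le_nw1 : n1 <= w1 by lia.
split; first by rewrite muln_gt0 n2gt0.
- nia.
- have h1 : w2 * n1.+1 <= n2 * n2 * n1.+1 by rewrite leq_mul.
  have h2 : n2 * w1 <= n2 * (n1 * n1) by rewrite leq_mul.
  nia.
rewrite mulnDl [leqRHS]mulnDr; apply: leq_add.
  have h : w2' * n2 * n1.+1 <= w2 * n2' * n1.+1 by rewrite leq_mul.
  nia.
(* All connected sets of [q1] against the sets through the new root, with the
   average [w2 / n2] replaced by its lower bound 1. *)
have branch : (w1 + w1') * n1.+1 <= (n1.+1 + w1) * (n1 + n1').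
  rewrite -(leq_pmul2l n1gt0).
  have h1 : n1 * ((w1 + w1') * n1.+1) <= w1 * n1.+1 * (n1 + n1').
    have := leq_mul mean1 (leqnn n1.+1); nia.
  apply: leq_trans h1 _; rewrite mulnA leq_mul //; nia.
have h : n2 * (n1.+1 + w1) <= w2 * n1.+1 + n2 * w1 by nia.
apply: leq_trans (_ : n2 * (n1.+1 + w1) * (n1 + n1') <= _); last by rewrite leq_mul.
by rewrite mulnCA -mulnA leq_mul // [leqRHS]mulnC mulnC.
Qed.

(** The profile of a path on [k.+1] vertices rooted at one of its ends. *)
Definition path_profile (k : nat) : profile :=
  iter k (join_profile point_profile) point_profile.

Local Open Scope ring_scope.

Lemma path_profileE (k : nat) (x : rat) : x = k.+1%:R ->
  [/\ (nroot (path_profile k))%:R = x,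
      (wroot (path_profile k))%:R = x * (x + 1) / 2,
      (nrest (path_profile k))%:R = x * (x - 1) / 2
    & (wrest (path_profile k))%:R = (x - 1) * x * (x + 1) / 6].
Proof.
elim: k x => [|k IH] x ->; first by split.
have [] := IH _ erefl; rewrite /path_profile iterS.
case: (iter k _ _) => n w n' w' /= nE wE n'E w'E.
by rewrite !mul1n !natrD nE n'E wE w'E -[in n.+1]addn1 natrD nE; split; field.
Qed.

(** Here [m] is the order of the straightened path, root included, and the claim
    is that a certain average stays below [(w - n) / (n - 1) + (m + 1) / 2].  It
    averages over subpaths and over sets avoiding the root.  Subpaths have
    average order [(m + 2) / 3], which is less than [(m + 1) / 2].  The sets
    avoiding the root have average at most [w / n], which exceeds
    [(w - n) / (n - 1)] by at most 1, whereas [(m + 1) / 2] is at least 2. *)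
Lemma core_profile_ineq (n w n' w' m : rat) :
  2 <= n -> 2 * n <= w + 1 -> 0 <= n' -> w' * n <= w * n' -> 3 <= m ->
  (w' + m * (m + 1) * (m + 2) / 6) * (n - 1) <
  (w - n + (n - 1) * (m + 1) / 2) * (n' + m * (m + 1) / 2).
Proof.
move=> n2 lo n'0 mean m3.
set K := w - n + (n - 1) * (m + 1) / 2.
have pathpart : m * (m + 1) * (m + 2) / 6 * (n - 1) < K * (m * (m + 1) / 2).
  rewrite -subr_gt0.
  have -> : K * (m * (m + 1) / 2) - m * (m + 1) * (m + 2) / 6 * (n - 1) =
    m * (m + 1) * (w - n + (n - 1) * (m - 1) / 6) / 2 by rewrite /K; field.
  rewrite divr_gt0 // mulr_gt0 //; first by rewrite mulr_gt0; lra.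
  rewrite addr_gt0; first lra.
  by lra.
  by rewrite divr_gt0 // mulr_gt0; lra.
have restpart : w' * (n - 1) <= K * n'.
  have n0 : 0 < n by lra.
  rewrite -(ler_pM2l n0).
  have h1 : (n - 1) * (w' * n) <= (n - 1) * (w * n') by rewrite ler_wpM2l //; lra.
  (* Divided by [n * (n - 1)] this is [w / n <= K / (n - 1)]. *)
  have h2 : (n - 1) * w <= n * K.
    have h3 : n * ((n - 1) * 4) <= n * ((n - 1) * (m + 1)).
      by rewrite ler_wpM2l ?ler_wpM2l //; lra.
    rewrite /K; nra.
  have h3 := ler_wpM2r n'0 h2.
  nra.
nra.
Qed.

(** The cross difference of the two means is [A * B] times the difference of the
    two sides of [core_profile_ineq], with [m = A + B + 1]. *)
Lemma total_profile_lt (q : profile) (a b : nat) : balanced q -> (1 < nroot q)%N ->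
  let t1 := join_profile (join_profile q (path_profile a)) (path_profile b) in
  let t2 := join_profile q (path_profile (a + b).+1) in
  (wroot t2 + wrest t2)%:R / (nroot t2 + nrest t2)%:R <
  (wroot t1 + wrest t1)%:R / (nroot t1 + nrest t1)%:R :> rat.
Proof.
move=> [n0 lo up mean] n1.
have [] := path_profileE (k := a) erefl; have [] := path_profileE (k := b) erefl.
have [] := path_profileE (k := (a + b).+1) erefl.
case: (path_profile _) => nC wC nC' wC'; case: (path_profile b) => nB wB nB' wB'.
case: (path_profile a) => nA wA nA' wA'.
case: q n0 lo up mean n1 => n w n' w' /=.
set C := (a + b).+2%:R : rat; set A := a.+1%:R : rat; set B := b.+1%:R : rat.
move=> n0 lo up mean n1 nCE wCE nC'E wC'E nBE wBE nB'E wB'E nAE wAE nA'E wA'E.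
have CE : C = A + B by rewrite /C /A /B -natrD addSn addnS.
have A1 : 1 <= A by rewrite ler1n.
have B1 : 1 <= B by rewrite ler1n.
have key := @core_profile_ineq n%:R w%:R n'%:R w'%:R (C + 1).
rewrite ltr_pdivrMr ?ltr0n ?addn_gt0 ?muln_gt0 ?n0 //.
rewrite mulrAC ltr_pdivlMr ?ltr0n ?addn_gt0 ?muln_gt0 ?n0 //.
rewrite !(natrD, natrM) -!natr1 nCE wCE nC'E wC'E nBE wBE nB'E wB'E nAE wAE nA'E wA'E CE.
have /key : (2 : rat) <= n%:R by rewrite ler_nat.
have lo' : (2 : rat) * n%:R <= w%:R + 1 by rewrite natr1 -natrM ler_nat mul2n.
have mean' : (w'%:R * n%:R <= w%:R * n'%:R :> rat) by rewrite -!natrM ler_nat.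
move=> /(_ lo' (ler0n _ _) mean'); have C3 : 3 <= C + 1 by lra.
(* The straightened path has the [C] moved vertices and the root. *)
move=> /(_ C3); rewrite -subr_gt0 CE => E.
have AB : 0 < A * B by rewrite mulr_gt0; lra.
rewrite -subr_gt0; apply: lt_le_trans (mulr_gt0 AB E) _.
by rewrite le_eqVlt; apply/orP; left; apply/eqP; field.
Qed.

Local Close Scope ring_scope.

(** * Trees have balanced profiles *)

(** The part [X1] is the branch of a neighbour [y] of [v], that is, the component
    of [y] once [v] is removed.  A second edge from [v] to that branch would close
    a cycle. *)
Lemma cut_at_root (V : finType) (e : rel V) (X : {set V}) (v : V) :
  symmetric e -> acyclic_graph e -> v \in X -> connected_in e X -> X != [set v] ->
  exists X1 X2 y, [/\ X = X2 :|: X1, bridged e X2 v X1 y,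
    connected_in e X1 & connected_in e X2].
Proof.
move=> esym acyc vX XC Xv; have /connected_inP[X0 cut] := XC.
have [||v' [y [/set1P-> yX yv evy]]] := cut [set v].
- by apply/set0Pn; exists v; rewrite inE.
- by rewrite properEneq eq_sym Xv sub1set.
rewrite inE in yv.
pose r := [rel a b | [&& a \in X :\ v, b \in X :\ v & e a b]].
have yXv : y \in X :\ v by rewrite !inE yv.
have rpath p : forall x, path r x p -> all [in X :\ v] p.
  by elim: p => //= z p IH x /andP[/and3P[_ -> _] /IH].
pose X1 := [set z | connect r y z].
have X1X z : z \in X1 -> z \in X :\ v.
  rewrite inE => /connectP[p rp ->]; have /allP allp := rpath _ _ rp.
  by have := mem_last y p; rewrite inE => /orP[/eqP->|/allp].
have br : bridged e (X :\: X1) v X1 y.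
  split=> //.
  - by rewrite inE vX andbT; apply/negP=> /X1X; rewrite !inE eqxx.
  - by rewrite inE connect0.
  - by rewrite disjoint_sym disjoints_subset setDE subsetIr.
  move=> x z /setDP[xX xX1] zX1 exz.
  have xv : x = v.
    apply/eqP; apply: contraR xX1 => xv; move: (zX1); rewrite !inE => yz.
    apply: connect_trans yz (connect1 _).
    by rewrite /= (X1X _ zX1) inE xX inE xv esym.
  split=> //; have := zX1; rewrite inE => /connectP[p0 rp0 zE].
  case/shortenP: rp0 zE => -[//|t p] rp up _ zE; case: (@acyc [:: v, y, t & p]) => //.
  have /allP allp := rpath _ _ rp.
  have vp : v \notin [:: y, t & p].
    by rewrite inE eq_sym (negPf yv); apply/negP=> /allp; rewrite !inE eqxx.
  rewrite /ucycle cons_uniq vp up /cycle rcons_path (_ : last v _ = z) ?zE //.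
  have evz : e z v by rewrite esym -xv.
  rewrite -zE evz !andbT; apply/andP; split=> //.
  by apply: sub_path rp => a b /and3P[].
have XE : X = X :\: X1 :|: X1.
  apply/setP=> z; rewrite !inE; case: (boolP (connect r y z)) => [yz|]; rewrite ?orbF ?orbT //=.
  by have := X1X z; rewrite !inE => /(_ yz)/andP[].
have [vX2 yX1 _ _ _] := br.
have X2n0 : X :&: (X :\: X1) != set0 by apply/set0Pn; exists v; rewrite inE vX.
have X1n0 : X :&: X1 != set0 by apply/set0Pn; exists y; rewrite inE yX.
have XI1 : X :&: X1 = X1 by apply/setIidPr/subsetP=> z /X1X; rewrite inE => /andP[].
have XI2 : X :&: (X :\: X1) = X :\: X1 by apply/setIidPr; rewrite subsetDl.
have subX : X \subset X :\: X1 :|: X1 by rewrite -XE subxx.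
exists X1, (X :\: X1), y; split=> //.
  rewrite -XI1.
  rewrite setUC in subX.
  by have [] := connected_in_split esym (bridged_sym esym br) subX XC X1n0 X2n0.
by rewrite -XI2; have [] := connected_in_split esym br subX XC X2n0 X1n0.
Qed.

(** Induction on the cut of [X] at an edge of the root.  The bound on [#|X|] serves
    to get a second connected set through the root as soon as [X] has a second
    vertex. *)
Lemma tree_balanced (V : finType) (e : rel V) (X : {set V}) (v : V) :
  symmetric e -> acyclic_graph e -> v \in X -> connected_in e X ->
  balanced (profile_of e X v) /\ #|X| <= nroot (profile_of e X v).
Proof.
move=> esym acyc; have [n] := ubnP #|X|; elim: n X v => // n IH X v ltX vX XC.
have [->|Xv] := eqVneq X [set v].
  by rewrite profile_point cards1; split=> //; apply: balanced_point.
have [X1 [X2 [y [XE br X1C X2C]]]] := cut_at_root esym acyc vX XC Xv.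
have [vX2 yX1 dX _ _] := br.
have cX : #|X| = #|X2| + #|X1|.
  by rewrite XE cardsU [X2 :&: _]setIC disjoint_setI0 // cards0 subn0.
have X1gt0 : 0 < #|X1| by apply/card_gt0P; exists y.
have X2gt0 : 0 < #|X2| by apply/card_gt0P; exists v.
have [|b1 le1] := IH X1 y _ yX1 X1C; first by lia.
have [|b2 le2] := IH X2 v _ vX2 X2C; first by lia.
rewrite cX XE (profile_join esym br); split; first exact: balanced_join.
case: (profile_of e X1 y) le1 => n1 w1 n1' w1'.
by case: (profile_of e X2 v) le2 => n2 w2 n2' w2' /=; nia.
Qed.

(** * Subtrees as connected vertex sets *)

Lemma set2_edges (V : finType) (e : rel V) (x y : V) :
  symmetric e -> ([set x; y] \in edges e) = e x y.
Proof.
move=> sym_e; apply/imsetP/idP=> [[[a b] /= eab /setP eqE]|exy]; last by exists (x, y); rewrite ?inE.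
rewrite inE /= in eab.
move: (eqE x) (eqE y) (eqE a) (eqE b); rewrite !inE !eqxx /= !orbT.
move=> /esym/orP[]/eqP-> /esym/orP[]/eqP-> //.
- by move=> _ /orP[]/eqP ba; move: eab; rewrite ba.
- by rewrite sym_e.
- by move=> /orP[]/eqP ab; move: eab; rewrite ab.
Qed.

(** Follow a walk from inside [R] to outside: some step of it leaves [R]. *)
Lemma connected_in_connect (V : finType) (e r : rel V) (S : {set V}) :
  S != set0 -> {in S &, forall x y, connect r x y} ->
  (forall x y, r x y -> e x y) -> (forall x y, r x y -> y \in S) -> connected_in e S.
Proof.
move=> S0 rC re rS; apply/connected_inP; split=> // R /set0Pn[x xR] /properP[/subsetP RS [y yS yR]].
have /connectP[p rp yE] := rC _ _ (RS _ xR) yS.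
elim: p x xR rp yE => [|z p IH] x xR /= => [_ yE|/andP[rxz rp] yE].
  by rewrite yE xR in yR.
have [zR|zR] := boolP (z \in R); first exact: IH zR rp yE.
by exists x, z; split=> //; [apply: rS rxz | apply: re].
Qed.

(** The edge set of a subtree is determined by its vertices: an edge of the graph
    between two vertices of the subtree but missing from it would close a cycle
    with a path of the subtree. *)
Lemma subtreesE (V : finType) (e : rel V) :
  simple_graph e -> acyclic_graph e ->
  subtrees e = (fun S : {set V} => (S, [set E in edges e | E \subset S])) @:
                 [set S : {set V} | connected_in e S].
Proof.
move=> [esym eirr] acyc; apply/setP=> -[S E]; apply/idP/imsetP => [|[S']].
  rewrite inE /is_subgraph /connected_subgraph /=.
  case/and3P=> /andP[/subsetP Ee /bigcupsP ES] S0 conn.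
  have {}conn x y : x \in S -> y \in S -> connect (fun a b => [set a; b] \in E) x y.
    by move=> xS yS; have /forall_inP/(_ x xS)/forall_inP/(_ y yS) := conn.
  have Eadj a b : [set a; b] \in E -> e a b by rewrite -set2_edges //; apply: Ee.
  exists S; first rewrite inE.
    apply: (@connected_in_connect _ _ (fun a b => [set a; b] \in E)) => //.
    by move=> x y /ES /subsetP; apply; rewrite !inE eqxx orbT.
  congr pair; apply/setP=> D; rewrite inE; apply/idP/andP=> [DE|[]].
    by rewrite (Ee _ DE) ES.
  case/imsetP=> -[x y]; rewrite inE /= => exy ->; rewrite subUset !sub1set => /andP[xS yS].
  have /connectP[p0 rp0 yE] := conn x y xS yS.
  case/shortenP: rp0 yE => -[|z [|t p]] rp up _ yE.
  - by rewrite yE /= eirr in exy.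
  - by rewrite yE; move: rp; rewrite /= andbT.
  case: (acyc [:: x, z, t & p]) => //; rewrite /ucycle up andbT.
  rewrite /cycle rcons_path -yE esym exy andbT.
  by apply: sub_path rp => a b; apply: Eadj.
rewrite inE => SC [-> ->]; rewrite inE /is_subgraph /connected_subgraph /=.
have /connected_inP[S0 cut] := SC; rewrite S0 /=; apply/andP; split.
  apply/andP; split; first by apply/subsetP=> D; rewrite inE => /andP[].
  by apply/bigcupsP=> D; rewrite inE => /andP[].
apply/forall_inP=> x xS; apply/forall_inP=> y yS.
set r := (fun a b => _).
pose R := [set z in S' | connect r x z].
have [|nRS] := boolP (S' \subset R); first by move=> /subsetP/(_ y yS); rewrite inE => /andP[].
have [||a [b [aR bS bR eab]]] := cut R.
- by apply/set0Pn; exists x; rewrite inE xS connect0.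
- by rewrite properE nRS andbT; apply/subsetP=> z; rewrite inE => /andP[].
case/negP: bR; rewrite inE bS /=; move: aR; rewrite inE => /andP[aS xa].
apply: connect_trans xa (connect1 _); rewrite /r inE set2_edges // eab /=.
by rewrite subUset !sub1set aS.
Qed.

Lemma mean_profile (V : finType) (e : rel V) (v : V) :
  simple_graph e -> acyclic_graph e -> let q := profile_of e [set: V] v in
  mean_subtree_order e = ((wroot q + wrest q)%:R / (nroot q + nrest q)%:R)%R.
Proof.
move=> simple acyc q; rewrite /mean_subtree_order.
have sumE (F : {set V} -> nat) : \sum_(H in subtrees e) F H.1 =
    \sum_(S in rooted_csets e [set: V] v) F S + \sum_(S in unrooted_csets e [set: V] v) F S.
  rewrite subtreesE // big_imset /= => [|S S' _ _ []//].
  rewrite (bigID (fun S : {set V} => v \in S)) /=; congr (_ + _); apply: eq_bigl => S.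
    by rewrite !inE subsetT.
  by rewrite !inE subsetT.
rewrite (sumE (fun S => #|S|)) -sum1_card (sumE (fun=> 1)).
by rewrite /q /profile_of /= -!sum1_card.
Qed.

(** * Induced paths *)

(** For a symmetric relation and a list without repetition this is an induced
    path in the usual sense.  The default value of [head] is harmless, as the test
    is run on the members of [p]. *)
Fixpoint induced_path (V : finType) (e : rel V) (s : seq V) : bool :=
  if s is x :: p then
    all [pred y | e x y == (y == head x p)] p && induced_path e p
  else true.

(** A chord would close a cycle with the stretch of path between its ends. *)
Lemma acyclic_induced_path (V : finType) (e : rel V) (x : V) (p : seq V) :
  symmetric e -> acyclic_graph e -> uniq (x :: p) -> path e x p ->
  induced_path e (x :: p).
Proof.
move=> esym acyc; elim: p x => // y p IH x /[dup] ux /andP[xp up] /= /andP[exy ep].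
apply/andP; split; last exact: IH; rewrite exy !eqxx /=.
apply/allP=> z zp /=; apply/eqP.
have -> : (z == y) = false by apply/eqP=> zy; move: up; rewrite /= -zy zp.
apply/negP=> exz; case/splitPr: zp ep ux => p1 p2 ep ux.
case: (acyc [:: x, y & rcons p1 z]) => //=; first by rewrite size_rcons.
move: ep; rewrite cat_path /= => /and3P[ep1 elz _].
rewrite /ucycle; apply/andP; split.
  by rewrite /cycle /= exy !rcons_path last_rcons ep1 elz esym.
move: ux; rewrite -cat_rcons -[_ :: y :: _]/([:: x, y & rcons p1 z] ++ p2).
by rewrite cat_uniq => /and3P[].
Qed.

Lemma bridged_cons (V : finType) (e : rel V) (x y : V) (p : seq V) :
  uniq [:: x, y & p] -> induced_path e [:: x, y & p] ->
  bridged e [set x] x [set z in y :: p] y.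
Proof.
move=> /andP[xp _] /andP[/allP all_p _]; split.
- by rewrite inE.
- by rewrite !inE eqxx.
- by rewrite disjoint_sym disjoints1 inE.
- by have := all_p y; rewrite /= eqxx mem_head => /(_ isT)/eqP.
by move=> _ z /set1P->; rewrite inE => /all_p/eqP/= -> /eqP.
Qed.

Lemma profile_path (V : finType) (e : rel V) (x : V) (p : seq V) :
  symmetric e -> uniq (x :: p) -> induced_path e (x :: p) ->
  profile_of e [set z in x :: p] x = path_profile (size p).
Proof.
move=> esym; elim: p x => [|y p IH] x up ip.
  by rewrite set_cons (_ : [set z in [::]] = set0) ?setU0 ?profile_point //; apply/setP=> z; rewrite !inE.
rewrite set_cons (profile_join esym (bridged_cons up ip)) profile_point IH //.
  by case/andP: up.
by case/andP: ip.
Qed.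

(** * Acyclicity along an attached path *)

Definition acyclic_in (V : finType) (e : rel V) (X : {set V}) : Prop :=
  forall c : seq V, 2 < size c -> {subset c <= X} -> ~ ucycle e c.

(** A vertex on a cycle has two distinct neighbours there, so the new vertex [z]
    lies on no cycle. *)
Lemma acyclic_in_leaf (V : finType) (e : rel V) (X : {set V}) (v z : V) :
  symmetric e -> acyclic_in e X -> (forall x, x \in X -> e x z -> x = v) ->
  acyclic_in e (z |: X).
Proof.
move=> esym acX leaf c; have [zc|zc] := boolP (z \in c); last first.
  move=> sc cX; apply: acX => // x xc; have := cX x xc.
  by rewrite !inE => /orP[/eqP xz|//]; rewrite -xz xc in zc.
have [i c1 rotc] := rot_to zc.
rewrite -(size_rot i) -(rot_ucycle i) rotc => sc cX.
have {}cX x : x \in c1 -> x != z -> x \in X.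
  move=> xc1 xz; have := cX x; rewrite -(mem_rot i) rotc !inE xc1 orbT (negPf xz).
  by move=> /(_ isT).
case: c1 rotc sc cX => // x; case/lastP=> // m y _ _ cX.
rewrite /ucycle /cycle [uniq _]/= -rcons_cons rcons_path last_rcons rcons_path.
rewrite mem_rcons !inE rcons_uniq !negb_or.
case/andP=> /andP[/= /andP[/andP[ezx _] _] eyz] /and3P[]; rewrite mem_rcons inE negb_or.
move=> /and3P[zy zx _] /andP[xy _] _.
have xv : x = v.
  by apply: leaf; [apply: cX; [rewrite mem_head | rewrite eq_sym] | rewrite esym].
have yv : y = v.
  by apply: leaf eyz; apply: cX; [rewrite inE mem_rcons mem_head orbT | rewrite eq_sym].
by rewrite xv yv eqxx in xy.
Qed.

(** The path is added one vertex at a time, each being a leaf when it arrives. *)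
Lemma acyclic_in_bridged_path (V : finType) (e : rel V) (X : {set V}) (v y : V)
    (p : seq V) : symmetric e -> uniq (y :: p) -> induced_path e (y :: p) ->
  bridged e X v [set z in y :: p] y -> acyclic_in e X ->
  acyclic_in e (X :|: [set z in y :: p]).
Proof.
move=> esym; elim: p X v y => [|t p IH] X v y up ip [vX _ dX evy cross] acX.
  have -> : X :|: [set z in [:: y]] = y |: X by apply/setP=> z; rewrite !inE orbC.
  by apply: (acyclic_in_leaf (v := v)) => // x xX exy; have [] := cross x y xX _ exy; rewrite ?inE ?eqxx.
rewrite set_cons setUCA setUA.
have [u1 up'] := andP up; have [i1 ip'] := andP ip.
have [_ tp dp eyt crossp] := bridged_cons up ip.
have notX z : z \in X -> z \in y :: t :: p = false.
  by move=> zX; have := disjointFl dX zX; rewrite inE.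
apply: (IH _ y) => //; last first.
  by apply: (acyclic_in_leaf (v := v)) => // x xX exy; have [] := cross x y xX _ exy; rewrite ?inE ?eqxx.
split=> //; first by rewrite !inE eqxx.
  rewrite disjoint_sym; apply/pred0P=> z /=; rewrite in_setU1 inE.
  have [->|_] := eqVneq z y; first by rewrite (negPf u1).
  case: (boolP (z \in X)) => //= /notX; rewrite inE => /negbT.
  by rewrite negb_or => /andP[_ /negPf].
move=> x z; rewrite in_setU1 => /orP[/eqP->|xX] zp exz.
  by apply: crossp => //; rewrite inE.
have zp' : z \in [set z in [:: y, t & p]] by move: zp; rewrite !inE => ->; rewrite orbT.
have [_ zy] := cross _ _ xX zp' exz.
by move: u1; rewrite -zy; move: zp; rewrite inE => ->.
Qed.

(** * Pendant paths and walks from their ends *)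

(** In an acyclic graph the last clause makes the end of [s] a leaf and gives its
    other vertices degree 2. *)
Definition pendant_path (V : finType) (e : rel V) (v : V) (s : seq V) : Prop :=
  [/\ uniq (v :: s), path e v s &
      forall z x, z \in s -> e z x -> x \in v :: s].

Lemma rev_uniq_path (V : finType) (e : rel V) (x : V) (p : seq V) :
  symmetric e -> uniq (x :: p) -> path e x p ->
  uniq (last x p :: rev (belast x p)) /\ path e (last x p) (rev (belast x p)).
Proof.
move=> esym up ep; split; first by rewrite -rev_rcons -lastI rev_uniq.
by rewrite rev_path; apply: sub_path ep => a b; rewrite esym.
Qed.

(** Along an induced path every step advances the position by at most one. *)
Lemma induced_path_index (V : finType) (e : rel V) (s : seq V) (x y : V) :
  uniq s -> induced_path e s -> x \in s -> y \in s -> e x y ->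
  index y s <= (index x s).+1.
Proof.
elim: s => // h s IH /andP[hs us] /andP[/allP all_h ips] xs ys exy.
have [yh|yh] := eqVneq y h; first by rewrite yh /= eqxx.
have {}ys : y \in s by move: ys; rewrite inE (negPf yh).
have [xh|xh] := eqVneq x h.
  have /eqP := all_h y ys; rewrite /= -{1}xh exy => /esym/eqP ->.
  by case: (s) ys => // t s' _ /=; rewrite !eqxx; case: eqP.
have {}xs : x \in s by move: xs; rewrite inE (negPf xh).
by rewrite /= ![h == _]eq_sym (negPf xh) (negPf yh) ltnS IH.
Qed.

Lemma pendant_bridged (V : finType) (e : rel V) (X : {set V}) (v a : V) (s : seq V) :
  symmetric e -> acyclic_graph e -> pendant_path e v (a :: s) -> v \in X ->
  [disjoint [set z in a :: s] & X] -> bridged e X v [set z in a :: s] a.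
Proof.
move=> esym acyc [us ps closed] vX dX.
have /andP[/allP all_v _] := acyclic_induced_path esym acyc us ps.
have [eva _] := andP ps.
split=> //; first by rewrite !inE eqxx.
move=> x z xX; rewrite inE => zs exz; have := closed z x zs; rewrite esym => /(_ exz).
rewrite inE; have := disjointFl dX xX; rewrite inE => ->; rewrite orbF => /eqP xv.
by split=> //; apply/eqP; have /eqP := all_v z zs; rewrite -xv exz => <-.
Qed.

(** Entering [a :: s] from the other path is only possible through [v]. *)
Lemma pendant_disjoint (V : finType) (e : rel V) (v a b : V) (s t : seq V) :
  symmetric e -> acyclic_graph e ->
  pendant_path e v (a :: s) -> pendant_path e v (b :: t) -> a != b ->
  forall z, z \in b :: t -> z \notin a :: s.
Proof.
move=> esym acyc [us ps closed] [ut pt _] ab.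
have /andP[/allP all_v _] := acyclic_induced_path esym acyc us ps.
have [evb {}pt] := andP pt; have /andP[vbt _] := ut.
have bs : b \notin a :: s.
  by apply/negP=> /all_v; rewrite /= evb; move: ab; rewrite eq_sym => /negPf->.
elim: t b pt bs vbt {ut evb ab} => [|c t IH] b /= pt bs vbt z.
  by rewrite inE => /eqP->.
case/andP: pt => ebc pt; rewrite in_cons => /orP[/eqP->//|].
move: vbt; rewrite in_cons negb_or => /andP[vb vct].
apply: IH pt _ vct z; apply/negP=> cs; have := closed c b cs.
by rewrite esym => /(_ ebc); rewrite in_cons eq_sym (negPf vb) (negPf bs).
Qed.

Lemma dist_le (V : finType) (e : rel V) (x : V) (p : seq V) :
  path e x p -> dist e x (last x p) <= size p.
Proof.
move=> ep; (* The distance never exceeds [#|V|], so long walks are no obstacle. *)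
rewrite /dist; have [ltp|gep] := ltnP (size p) #|V|; last first.
  by apply: leq_trans gep; rewrite -[leqRHS](size_iota 0); apply: find_size.
rewrite leqNgt; apply/negP=> lt; have := before_find 0 lt.
rewrite nth_iota // add0n => /existsP[]; exists (in_tuple p).
by rewrite /= ep eqxx.
Qed.

Lemma distP (V : finType) (e : rel V) (x y : V) : dist e x y < #|V| ->
  exists p, [/\ path e x p, last x p = y & size p = dist e x y].
Proof.
rewrite /dist => lt; have := lt; rewrite -{2}(size_iota 0 #|V|) -has_find.
move=> /(nth_find 0); rewrite nth_iota // add0n => /existsP[p /andP[ep /eqP lp]].
by exists p; rewrite size_tuple.
Qed.

Lemma eq_set2 (V : finType) (x y a b : V) :
  ([set x; y] == [set a; b]) = ((x == a) && (y == b)) || ((x == b) && (y == a)).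
Proof.
apply/eqP/idP=> [/setP eqE|]; last first.
  by case/orP=> /andP[/eqP-> /eqP->] //; rewrite setUC.
move: (eqE x) (eqE y) (eqE a) (eqE b); rewrite !inE !eqxx /= !orbT.
rewrite ![a == _]eq_sym ![b == _]eq_sym.
by case: (x == a); case: (x == b); case: (y == a); case: (y == b).
Qed.

(** Two induced paths joined by a single edge, from the end of one to the start
    of the other, form one induced path. *)
Lemma induced_path_cat (V : finType) (e : rel V) (p q : seq V) (w u : V) :
  induced_path e (rcons p w) -> induced_path e (u :: q) ->
  uniq (rcons p w ++ u :: q) ->
  (forall x z, x \in rcons p w -> z \in u :: q -> e x z = (x == w) && (z == u)) ->
  induced_path e (rcons p w ++ u :: q).
Proof.
move=> ip iq; elim: p ip => [|x p IH] ip up cross.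
  apply/andP; split=> //; apply/allP=> z zq /=.
  by rewrite cross // ?inE ?eqxx //.
move: ip up; rewrite rcons_cons /= => /andP[/allP allx ip] /andP[xp up].
apply/andP; split; last first.
  by apply: IH => // y z yp zq; apply: cross => //; rewrite rcons_cons inE yp orbT.
have hE : head x (rcons p w ++ u :: q) = head x (rcons p w) by case: (p).
have hp : head x (rcons p w) \in rcons p w by case: (p) => [|? ?]; rewrite mem_head.
apply/allP=> z; rewrite mem_cat hE /= => /orP[/allx //|zq].
have wx : x != w by apply: contraNneq xp => ->; rewrite mem_cat mem_rcons mem_head.
rewrite cross ?rcons_cons ?mem_head // (negPf wx) eq_sym eqbF_neg.
apply: contraTneq up => zh; rewrite cat_uniq !negb_and negbK.
by apply/orP; right; apply/orP; left; apply/hasP; exists z; rewrite // zh.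
Qed.

(** A walk can leave [rcons q v] only through [v], and it advances by at most one
    position per step. *)
Lemma walk_index (V : finType) (e : rel V) (q : seq V) (v x : V) (s : seq V) :
  uniq (rcons q v) -> induced_path e (rcons q v) ->
  (forall z y, z \in q -> e z y -> y \in rcons q v) ->
  x \in rcons q v -> path e x s -> index x (rcons q v) + size s <= size q ->
  {subset s <= rcons q v} /\
  index (last x s) (rcons q v) <= index x (rcons q v) + size s.
Proof.
move=> uq iq closed; elim: s x => [|t s IH] x xq /= ; first by rewrite addn0.
case/andP=> ext ets le.
have xq' : x \in q.
  by apply: contraLR le => nxq; rewrite -cats1 index_cat (negPf nxq) -ltnNge addnS ltnS -addnA leq_addr.
have tq := closed x t xq' ext.
have it := induced_path_index uq iq xq tq ext.
have [|sub lei] := IH t tq ets; first by lia.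
by split; [move=> z; rewrite inE => /orP[/eqP->|/sub] | lia].
Qed.

Lemma pendant_rev (V : finType) (e : rel V) (v : V) (s : seq V) :
  symmetric e -> acyclic_graph e -> pendant_path e v s ->
  [/\ uniq (rcons (rev s) v), induced_path e (rcons (rev s) v) &
      path e (last v s) (rev (belast v s))].
Proof.
move=> esym acyc [us ps _]; have [ur pr] := rev_uniq_path esym us ps.
rewrite -rev_cons lastI rev_rcons; split=> //.
exact: acyclic_induced_path.
Qed.

(** Read from its free end, a pendant path can be left only after as many steps as
    it has vertices.  This controls the distances in the definition of a standard
    associate. *)
Lemma pendant_walk (V : finType) (e : rel V) (v : V) (s p : seq V) :
  symmetric e -> acyclic_graph e -> pendant_path e v s ->
  path e (last v s) p -> size p <= size s ->
  {subset p <= v :: s} /\ (size p < size s -> last (last v s) p \in s).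
Proof.
move=> esym acyc pend pp szp.
have [ur ir _] := pendant_rev esym acyc pend; have [_ _ closed] := pend.
have memE : rcons (rev s) v =i v :: s by move=> z; rewrite -rev_cons mem_rev.
have iw : index (last v s) (rcons (rev s) v) = 0.
  by rewrite -rev_cons lastI rev_rcons /= eqxx.
have [|||sub lei] := walk_index ur ir _ _ pp.
- by move=> z y; rewrite mem_rev memE; apply: closed.
- by rewrite memE mem_last.
- by rewrite iw size_rev.
split=> [z /sub|lt]; first by rewrite memE.
rewrite -mem_rev; apply: contraLR lt => nl.
move: lei; rewrite iw add0n -cats1 index_cat (negPf nl) size_rev -leqNgt.
by apply: leq_trans; apply: leq_addr.
Qed.

Lemma pendant_dist (V : finType) (e : rel V) (v a : V) (s : seq V) :
  symmetric e -> acyclic_graph e -> pendant_path e v (a :: s) ->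
  dist e (last a s) v <= (size s).+1.
Proof.
move=> esym acyc pend; have [_ _] := pendant_rev esym acyc pend.
move=> /dist_le; rewrite size_rev size_belast /= rev_cons last_rcons.
by [].
Qed.

Lemma pendant_end_deg (V : finType) (e : rel V) (v a : V) (s : seq V) :
  simple_graph e -> acyclic_graph e -> pendant_path e v (a :: s) ->
  deg e (last a s) = 1.
Proof.
move=> [sym_e eirr] acyc pend; have [_] := pendant_rev sym_e acyc pend.
have [us ps closed] := pend.
rewrite -rev_cons (lastI v) rev_rcons; set w := last v _; set r := rev _.
have -> : last a s = w by [].
have rE : r = rcons (rev (belast a s)) v by rewrite /r /= rev_cons.
have rn0 : head w r \in r by rewrite rE; case: (rev _) => [|? ?]; rewrite mem_head.
move=> /andP[/allP all_w _] _; rewrite /deg.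
suff -> : [set y | e w y] = [set head w r] by rewrite cards1.
apply/setP=> y; rewrite !inE; apply/idP/eqP=> [ewy|->].
  have wA : w \in a :: s by rewrite /w /= mem_last.
  have := closed w y wA ewy; rewrite lastI mem_rcons inE => /orP[/eqP yw|yb].
    by rewrite yw -/w eirr in ewy.
  have yr : y \in r by rewrite mem_rev.
  by have /eqP := all_w y yr; rewrite ewy => /esym/eqP.
by have /eqP := all_w _ rn0; rewrite eqxx.
Qed.

(** A walk from the leaf to a branching vertex has to traverse the whole pendant
    path, so [v] is nearest; a shortest walk to [v] has no time to leave that
    path, so it misses [b]. *)
Lemma fork_standard_associate (V : finType) (e : rel V) (v a b : V) (s t : seq V) :
  simple_graph e -> acyclic_graph e ->
  pendant_path e v (a :: s) -> pendant_path e v (b :: t) -> a != b ->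
  2 < deg e v -> (forall z, z \in a :: s -> deg e z <= 2) ->
  standard_1_associate e (move_edge e v b (last a s)).
Proof.
move=> simple acyc pendA pendB ab degv degA; have [esym eirr] := simple.
have bA : b \notin a :: s.
  by apply: (pendant_disjoint esym acyc pendA pendB ab); rewrite mem_head.
have [ub /andP[evb _] _] := pendB.
have bv : b != v by case/andP: ub; rewrite inE negb_or eq_sym => /andP[].
exists (last a s), v, b; split=> //.
- exact: pendant_end_deg pendA.
(* A vertex not reached from the leaf is at distance [#|V|], which exceeds the
   length of the pendant path because [v] is a further vertex. *)
- split=> // x degx; apply: leq_trans (pendant_dist esym acyc pendA) _.
  have [ltd|ged] := ltnP (dist e (last a s) x) #|V|; last first.
    apply: leq_trans ged; have [us _ _] := pendA.
    have := max_card [in v :: a :: s]; rewrite (card_uniqP us) /=; lia.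
  have [p [ep lp szp]] := distP ltd; rewrite leqNgt -szp; apply/negP=> ltp.
  have [|_ /(_ ltp)] := pendant_walk esym acyc pendA ep; first exact: ltnW.
  by rewrite /= lp => /degA; rewrite leqNgt degx.
split=> // p /and3P[ep _ /eqP szp].
have [|sub _] := pendant_walk esym acyc pendA ep.
  by rewrite szp; apply: pendant_dist pendA.
rewrite inE negb_or; apply/andP; split.
  by apply: contraNneq bA => ->; apply: mem_last.
by apply/negP=> /sub; rewrite inE (negPf bv) (negPf bA).
Qed.

(** * Straightening two pendant paths *)

Lemma move_edgeE (V : finType) (e : rel V) (v u w x y : V) :
  move_edge e v u w x y =
  e x y && ~~ ((x == v) && (y == u) || (x == u) && (y == v)) ||
  ((x == u) && (y == w) || (x == w) && (y == u)).
Proof. by rewrite /move_edge !eq_set2. Qed.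

Lemma move_edge_simple (V : finType) (e : rel V) (v u w : V) :
  simple_graph e -> u != w -> simple_graph (move_edge e v u w).
Proof.
move=> [esym eirr] uw; split=> [x y|x].
  by rewrite /move_edge esym (setUC [set x]).
by rewrite move_edgeE eirr /=; have [->|_] := eqVneq x u; rewrite ?(negPf uw) ?andbF.
Qed.

Lemma move_edge_off (V : finType) (e : rel V) (v u w : V) (Q : {set V}) :
  u \notin Q -> {in Q &, move_edge e v u w =2 e}.
Proof.
move=> uQ x y xQ yQ; rewrite move_edgeE.
have /negPf-> : x != u by apply: contraNneq uQ => <-.
have /negPf-> : y != u by apply: contraNneq uQ => <-.
by rewrite !andbF /= andbT orbF.
Qed.

Lemma eq_acyclic_in (V : finType) (e e' : rel V) (X : {set V}) :
  {in X &, e =2 e'} -> acyclic_in e X -> acyclic_in e' X.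
Proof.
move=> ee' acX c sc cX /andP[cyc uc]; case: (acX c sc cX); rewrite /ucycle uc andbT.
apply: (sub_in_cycle (P := [in X])) cyc; last by apply/allP=> x /cX.
by move=> x y xX yX; rewrite ee'.
Qed.

Lemma eq_induced_path (V : finType) (e e' : rel V) (p : seq V) :
  {in p &, e =2 e'} -> induced_path e p = induced_path e' p.
Proof.
elim: p => //= x p IH ee'; congr (_ && _); last first.
  by apply: IH => y z yp zp; apply: ee'; rewrite inE ?yp ?zp orbT.
by apply: eq_in_all => y yp /=; rewrite ee' // inE ?eqxx ?yp ?orbT.
Qed.

Lemma tree_connected_in (V : finType) (e : rel V) :
  connected_graph e -> connected_in e [set: V].
Proof.
move=> [/card_gt0P[x _] conn]; apply: (@connected_in_connect _ _ e) => //.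
by apply/set0Pn; exists x.
Qed.

Lemma bridged_connected (V : finType) (e : rel V) (X1 X2 : {set V}) (v y : V) :
  symmetric e -> bridged e X2 v X1 y -> connected_in e (X2 :|: X1) ->
  connected_in e X2.
Proof.
move=> esym br XC; have [vX2 yX1 _ _ _] := br.
have XI : (X2 :|: X1) :&: X2 = X2 by apply/setIidPr; apply: subsetUl.
rewrite -XI; apply: (proj2 (connected_in_split esym br _ XC _ _)) => //.
  by apply/set0Pn; exists v; rewrite !inE vX2.
by apply/set0Pn; exists y; rewrite !inE yX1 orbT.
Qed.

(** With [Q] the complement of the two paths, the tree is [Q] with the two paths
    attached at [v] one after the other, and its associate is [Q] with their
    concatenation attached at [v].  Both graphs agree on [Q], so
    [total_profile_lt] applies. *)
Lemma fork_mean_lt (V : finType) (e : rel V) (v a b : V) (s t : seq V) :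
  is_tree e -> pendant_path e v (a :: s) -> pendant_path e v (b :: t) -> a != b ->
  2 < deg e v ->
  (mean_subtree_order (move_edge e v b (last a s)) < mean_subtree_order e)%R.
Proof.
move=> [simple conn acyc] pendA pendB ab degv; have [esym eirr] := simple.
set w := last a s; set e' := move_edge e v b w.
set A := [set z in a :: s]; set B := [set z in b :: t].
pose Q := ~: (A :|: B).
have [uA pA clA] := pendA; have [uB pB clB] := pendB.
have disjAB : [disjoint A & B].
  rewrite disjoint_sym; apply/pred0P=> z /=; rewrite !in_set; apply/negP=> /andP[zB].
  by apply/negP; apply: (pendant_disjoint esym acyc pendA pendB ab).
have uA' : uniq (a :: s) by case/andP: uA.
have uB' : uniq (b :: t) by case/andP: uB.
have vA : v \notin A by rewrite inE; case/andP: uA.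
have vB : v \notin B by rewrite inE; case/andP: uB.
have vQ : v \in Q by rewrite in_setC in_setU negb_or vA.
have aA : a \in A by rewrite !inE eqxx.
have bB : b \in B by rewrite !inE eqxx.
have wA : w \in A by rewrite inE mem_last.
have bA : b \notin A by rewrite (disjointFl disjAB bB).
have wB : w \notin B by rewrite (disjointFr disjAB wA).
have bw : b != w by apply: contraNneq wB => <-.
have bQ : b \notin Q by rewrite /Q in_setC in_setU bB orbT.
have wQ : w \notin Q by rewrite /Q in_setC in_setU wA.
have ee' : {in Q &, e' =2 e} by apply: move_edge_off.
have brA : bridged e Q v A a.
  apply: (pendant_bridged esym acyc pendA vQ).
  by rewrite disjoints_subset setCK subsetUl.
have brB : bridged e (Q :|: A) v B b.
  apply: (pendant_bridged esym acyc pendB); first by rewrite inE vQ.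
  rewrite disjoints_subset setCU /Q setCK subsetI subsetUr -disjoints_subset.
  by rewrite disjoint_sym disjAB.
have QAB : Q :|: A :|: B = [set: V].
  by rewrite -setUA setUC /Q setUCr.
have [iA iB] : induced_path e (a :: s) /\ induced_path e (b :: t).
  have /andP[_ iA] := acyclic_induced_path esym acyc uA pA.
  by have /andP[_ iB] := acyclic_induced_path esym acyc uB pB.
have profT : profile_of e [set: V] v =
    join_profile (join_profile (profile_of e Q v) (path_profile (size s))) (path_profile (size t)).
  rewrite -QAB (profile_join esym brB) (profile_join esym brA) !profile_path //.
have simple' : simple_graph e' by apply: move_edge_simple.
have [esym' eirr'] := simple'.
have ABE : [set z in a :: (s ++ b :: t)] = A :|: B.
  by apply/setP=> z; rewrite !(inE, mem_cat) !orbA.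
have uAB : uniq (a :: s ++ b :: t).
  rewrite -cat_cons cat_uniq uA' uB' andbT; apply/hasPn=> z zB /=.
  by have := disjointFl disjAB (_ : z \in B); rewrite inE zB inE => /(_ isT) ->.
have iAB : induced_path e' (a :: s ++ b :: t).
  have AE : a :: s = rcons (belast a s) w by rewrite lastI.
  rewrite -cat_cons AE; apply: induced_path_cat.
  - rewrite -AE -(eq_induced_path (e := e)) // => x y xA yA.
    have xA' : x \in A by rewrite inE.
    by rewrite /e' (@move_edge_off _ _ _ _ _ A) // inE.
  - rewrite -(eq_induced_path (e := e)) // => x y xB yB.
    have nv z : z \in b :: t -> z == v = false.
      by move=> zB; apply/eqP=> zv; move: vB; rewrite inE -zv zB.
    have nw z : z \in b :: t -> z == w = false.
      by move=> zB; apply/eqP=> zv; move: wB; rewrite inE -zv zB.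
    by rewrite /e' move_edgeE !nv ?nw // !andbF andbT orbF.
  - by rewrite -AE.
  move=> x z; rewrite -AE => xA zB; rewrite /e' move_edgeE.
  have xb : x == b = false by apply/eqP=> xb; move: bA; rewrite inE -xb xA.
  have xv : x == v = false by apply/eqP=> xv; move: vA; rewrite inE -xv xA.
  have nexz : e x z = false.
    apply/negP=> exz; have := clA x z xA exz; rewrite in_cons.
    have -> : z == v = false by apply/eqP=> zv; move: vB; rewrite inE -zv zB.
    by have := disjointFl disjAB (_ : z \in B); rewrite inE zB [_ \in A]inE => /(_ isT) ->.
  by rewrite nexz xb.
have brAB : bridged e' Q v (A :|: B) a.
  split=> //; first by rewrite inE aA.
    by rewrite disjoint_sym disjoints_subset.
    rewrite /e' move_edgeE; case/andP: pA => -> _; rewrite (negPf ab) andbF /=.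
    have av : (a == v) = false by apply/eqP=> av; move: vA; rewrite -av aA.
    by rewrite av !andbF.
  move=> x z xQ zAB; rewrite /e' move_edgeE.
  have xb : x == b = false by apply/eqP=> xb; rewrite -xb xQ in bQ.
  have xw : x == w = false by apply/eqP=> xw; rewrite -xw xQ in wQ.
  rewrite xb xw /= !orbF => /andP[exz].
  case/setUP: zAB => [zA|zB]; first by have [_ _ _ _ /(_ _ _ xQ zA exz)] := brA.
  have xQA : x \in Q :|: A by rewrite inE xQ.
  by have [_ _ _ _ /(_ _ _ xQA zB exz)[-> ->]] := brB; rewrite !eqxx.
have QABE : Q :|: [set z in a :: s ++ b :: t] = [set: V] by rewrite ABE setUA.
have acyc' : acyclic_graph e'.
  have : acyclic_in e' (Q :|: [set z in a :: s ++ b :: t]).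
    apply: (acyclic_in_bridged_path esym' uAB iAB (v := v)); first by rewrite ABE.
    apply: (eq_acyclic_in (e := e)) => [x y xQ yQ|c sc _]; first by rewrite ee'.
    exact: acyc.
  by rewrite QABE => ac c sc; apply: ac => // z _; rewrite in_setT.
have profT' : profile_of e' [set: V] v =
    join_profile (profile_of e Q v) (path_profile (size s + size t).+1).
  rewrite -QABE (profile_join esym' (y := a)); last by rewrite ABE.
  by rewrite profile_path // size_cat -[size (b :: t)]/(size t).+1 addnS (eq_profile v ee').
have QC : connected_in e Q.
  apply: (bridged_connected esym brA); apply: (bridged_connected esym brB).
  by rewrite QAB; apply: tree_connected_in.
have [bal leQ] := tree_balanced esym acyc vQ QC.
rewrite (mean_profile v simple acyc) (mean_profile v simple' acyc') profT profT'.
apply: total_profile_lt => //; apply: leq_trans leQ.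
(* A third neighbour of [v] lies in [Q], so [{v}] is not all of [Q]. *)
have : ~~ ([set y | e v y] \subset [set a; b]).
  apply/negP=> /subset_leq_card; rewrite cards2 ab leqNgt.
  by rewrite -/(deg e v) degv.
case/subsetPn=> y; rewrite !inE negb_or => evy /andP[ya yb].
rewrite (cardsD1 v) vQ ltnS; apply/card_gt0P; exists y; rewrite in_setD1.
have -> : y != v by apply/eqP=> yv; rewrite yv eirr in evy.
rewrite in_setC in_setU negb_or /=; apply/andP; split; apply/negP=> yAB.
  by have [_ _ _ _ /(_ v y vQ yAB evy)[_ yE]] := brA; rewrite yE eqxx in ya.
have vQA : v \in Q :|: A by rewrite in_setU vQ.
by have [_ _ _ _ /(_ v y vQA yAB evy)[_ yE]] := brB; rewrite yE eqxx in yb.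
Qed.

(** * Existence of two pendant paths *)

Lemma exists_longest (V : finType) (P : pred (seq V)) (s0 : seq V) :
  P s0 -> (forall s, P s -> uniq s) ->
  exists2 s, P s & forall s', P s' -> size s' <= size s.
Proof.
move=> P0 Pu; pose sized n := [exists t : n.-tuple V, P t].
have sizedP s : P s -> sized (size s) by move=> Ps; apply/existsP; exists (in_tuple s).
have ub n : sized n -> n <= #|V|.
  case/existsP=> t /Pu /card_uniqP; rewrite size_tuple => <-; exact: max_card.
have ex : exists n, sized n by exists (size s0); apply: sizedP.
case: (ex_maxnP ex ub) => n /existsP[t Pt] maxn.
by exists t => // s' /sizedP/maxn; rewrite size_tuple.
Qed.

Definition graph_path (V : finType) (e : rel V) (s : seq V) : bool :=
  uniq s && sorted e s.

Lemma graph_path_induced (V : finType) (e : rel V) (s : seq V) :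
  symmetric e -> acyclic_graph e -> graph_path e s -> induced_path e s.
Proof. by case: s => // x s esym acyc /andP[us ps]; apply: acyclic_induced_path. Qed.

Lemma graph_path_suffix (V : finType) (e : rel V) (s1 s2 : seq V) :
  graph_path e (s1 ++ s2) -> graph_path e s2.
Proof.
by rewrite /graph_path cat_uniq => /andP[/and3P[_ _ ->] /cat_sorted2[]].
Qed.

(** The two neighbours along the path already exhaust the degree. *)
Lemma graph_path_inner (V : finType) (e : rel V) (s1 s2 : seq V) (b z c x : V) :
  symmetric e -> graph_path e (rcons s1 b ++ [:: z, c & s2]) -> deg e z <= 2 ->
  e z x -> x \in [set b; c].
Proof.
move=> esym; rewrite cat_rcons => /graph_path_suffix/andP[/= /and3P[bzc _ _] /and3P[ebz ezc _]].
move=> degz ezx; have bc : b != c by move: bzc; rewrite !inE !negb_or => /and3P[].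
have sub : [set b; c] \subset [set y | e z y].
  by rewrite subUset !sub1set !inE ezc esym ebz.
have /eqP/setP/(_ x) : [set b; c] == [set y | e z y] by rewrite eqEcard sub cards2 bc.
by rewrite [x \in [set y | _]]inE ezx.
Qed.

(** Prolong the path [[:: y, v & p]] as far as possible beyond [y].  A neighbour of
    a vertex added this way lies on the path: for the last vertex because no
    prolongation is left and there are no chords, for the others because of
    their degree. *)
Lemma exists_pendant (V : finType) (e : rel V) (v y : V) (p : seq V) :
  simple_graph e -> acyclic_graph e -> graph_path e [:: y, v & p] ->
  (forall z q, graph_path e (q ++ v :: p) -> z \in q -> deg e z <= 2) ->
  exists s, pendant_path e v (y :: s) /\ (forall z, z \in y :: s -> deg e z <= 2).
Proof.
move=> [sym_e eirr] acyc p0 low.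
have [|q qpath maxq] :=
  @exists_longest _ (fun q => graph_path e (rcons q y ++ v :: p)) [::] p0.
  by move=> q; rewrite /graph_path cat_uniq rcons_uniq => /andP[/andP[/andP[_ ->]]].
have memE z : (z \in y :: rev q) = (z \in rcons q y) by rewrite -rev_rcons mem_rev.
exists (rev q); split; last by move=> z; rewrite memE; apply: low.
have := qpath; rewrite -cat_rcons => /andP[]; rewrite cat_uniq => /andP[uq _] /cat_sorted2[sq _].
split; first by rewrite -rev_rcons -rev_rcons rev_uniq.
  rewrite -[path _ _ _]/(sorted e (v :: y :: rev q)) -rev_rcons -rev_rcons rev_sorted.
  by move: sq; apply: sub_sorted => a b; rewrite sym_e.
move=> z x; rewrite memE [x \in _]in_cons memE => zq ezx.
have zx : x != z by apply: contraTneq ezx => ->; rewrite eirr.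
suff : x \in rcons q y ++ [:: v].
  by rewrite mem_cat inE orbC.
have degz := low z _ qpath zq.
have [q1 [q2 defq]] : exists q1 q2, rcons q y = q1 ++ z :: q2.
  by case/splitPr: zq => q1 q2; exists q1, q2.
rewrite defq in qpath *.
(* [c] is the vertex after [z] on the path; it is [v] when [z] is [y]. *)
have [c [r [cE cq]]] : exists c r, q2 ++ v :: p = c :: r /\ c \in q2 ++ [:: v].
  by case: (q2) => [|c r]; [exists v, p | exists c, (r ++ v :: p)]; rewrite ?mem_head.
rewrite -catA mem_cat /=.
case/lastP: q1 defq qpath => [|q1 b] defq; rewrite -catA cat_cons cE => qpath.
  have [xL|xL] := boolP (x \in z :: c :: r).
    have xcr : x \in c :: r by case/predU1P: xL zx => [->|//]; rewrite eqxx.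
    have /andP[/allP/(_ x xcr) /eqP] := graph_path_induced sym_e acyc qpath.
    by rewrite ezx /= => /esym/eqP-> _; rewrite inE cq orbT.
  suff /maxq : graph_path e (rcons (x :: q) y ++ v :: p) by rewrite ltnn.
  rewrite rcons_cons defq /= cE.
  have [uz sz] := andP qpath; rewrite /graph_path cons_uniq xL uz.
  by rewrite -[sorted _ _]/(e x z && sorted e (z :: c :: r)) sym_e ezx.
have := graph_path_inner sym_e qpath degz ezx.
by rewrite !inE => /orP[/eqP->|/eqP->]; rewrite ?mem_rcons ?mem_head ?cq ?orbT.
Qed.

(** The path [v :: p] is a longest one starting at a branching vertex.  No chord
    leaves [v], so at most one of its three neighbours lies on [p]; each of the
    others starts a pendant path, since a path ending in [v :: p] that started at
    another branching vertex would be longer. *)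
Lemma exists_fork (V : finType) (e : rel V) (v0 : V) :
  simple_graph e -> acyclic_graph e -> 2 < deg e v0 ->
  exists v a b s t, [/\ 2 < deg e v, a != b, pendant_path e v (a :: s),
    pendant_path e v (b :: t) & forall z, z \in a :: s -> deg e z <= 2].
Proof.
move=> simple acyc deg0; have [esym eirr] := simple.
pose branched (L : seq V) := graph_path e L && (if L is v :: _ then 2 < deg e v else false).
have [||[|v p] /andP[vp //] degv maxL] := @exists_longest _ branched [:: v0].
- by rewrite /branched.
- by move=> L /andP[/andP[]].
have low z q : graph_path e (q ++ v :: p) -> z \in q -> deg e z <= 2.
  move=> qp zq; rewrite leqNgt; apply/negP=> degz.
  case/splitPr: zq qp => q1 q2; rewrite -catA cat_cons => /graph_path_suffix zp.
  have := maxL (z :: q2 ++ v :: p); rewrite /branched zp degz => /(_ isT).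
  by rewrite /= size_cat /= addnS -ltnS; lia.
have grow y : y \in [set y | e v y] :\ head v p -> exists s, pendant_path e v (y :: s) /\
    (forall z, z \in y :: s -> deg e z <= 2).
  rewrite !inE => /andP[yh evy]; apply: exists_pendant low => //.
  have yv : y != v by apply: contraTneq evy => ->; rewrite eirr.
  have yp : y \notin p.
    apply: contra yh => yp; have /andP[/allP/(_ y yp) /eqP <-] := graph_path_induced esym acyc vp.
    by [].
  by move: vp; rewrite /graph_path [uniq (y :: _)]cons_uniq inE negb_or yv yp /= esym evy.
have : 1 < #|[set y | e v y] :\ head v p|.
  have := cardsD1 (head v p) [set y | e v y]; rewrite -/(deg e v).
  by case: (_ \in _) => /= h; move: degv; rewrite h //; lia.
case/card_gt1P=> a [b [aN bN ab]].
have [s [pa lowa]] := grow a aN; have [t [pb _]] := grow b bN.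
by exists v, a, b, s, t.
Qed.

(** * Trees without branching vertices *)

Lemma induced_path_nth (V : finType) (e : rel V) (x0 : V) (s : seq V) (i j : nat) :
  uniq s -> induced_path e s -> i < j < size s ->
  e (nth x0 s i) (nth x0 s j) = (i.+1 == j).
Proof.
elim: s i j => [|x s IH] [|i] [|j] //; rewrite ?ltn0 ?andbF //=.
  case/andP=> xs us /andP[/allP all_x _] js; rewrite ltnS in js.
  have /eqP-> := all_x _ (mem_nth x0 js).
  by rewrite -nth0 (set_nth_default x0) ?nth_uniq ?(leq_ltn_trans _ js) // eq_sym.
by case/andP=> _ us /andP[_ ips]; rewrite !ltnS eqSS; apply: IH.
Qed.

(** A longest path contains all the neighbours of its vertices, by maximality at
    its ends and by the degree bound elsewhere; by connectedness it visits every
    vertex. *)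
Lemma path_graph_of_low_degree (V : finType) (e : rel V) :
  is_tree e -> (forall z, deg e z <= 2) -> is_path_graph e.
Proof.
move=> [[esym eirr] [/card_gt0P[v0 _] conn] acyc] low.
have [||L Lp maxL] := @exists_longest _ (graph_path e) [:: v0] => //.
  by move=> s /andP[].
have closed_L z x : z \in L -> e z x -> x \in L.
  move=> zL ezx; apply/negPn/negP=> xL.
  have [q1 [q2 defL]] : exists q1 q2, L = q1 ++ z :: q2.
    by case/splitPr: zL => q1 q2; exists q1, q2.
  have := Lp; rewrite defL.
  case/lastP: q1 defL => [|q1 b] defL.
    move=> _; suff /maxL : graph_path e (x :: L) by rewrite ltnn.
    by move: Lp xL; rewrite defL /graph_path /= => /andP[-> ->] ->; rewrite esym ezx.
  case: q2 defL => [|c q2] defL.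
    move=> _; suff /maxL : graph_path e (rcons L x) by rewrite size_rcons ltnn.
    move: Lp xL; rewrite defL /graph_path rcons_uniq => /andP[-> sL] -> /=.
    rewrite cats1 in sL *; case: (rcons q1 b) sL => [|h r] /= sL; first by rewrite ezx.
    by rewrite rcons_path sL last_rcons.
  move=> Lp'; have := graph_path_inner esym Lp' (low z) ezx.
  case/set2P=> xE; move: xL; rewrite defL xE mem_cat.
    by rewrite mem_rcons mem_head.
  by rewrite !inE eqxx !orbT.
have [uL sL] := andP Lp.
have L0 : 0 < size L by apply: leq_trans (maxL [:: v0] _).
have allL x : x \in L.
  pose h := head v0 L; have hL : h \in L by rewrite /h -nth0 mem_nth.
  have cl : closed e [in L].
    by move=> a b eab; apply/idP/idP=> /closed_L; apply; rewrite // esym.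
  by have <- : (h \in L) = (x \in L) := closed_connect cl (conn h x).
have szL : size L = #|V| by rewrite -(card_uniqP uL); apply: eq_card => x; rewrite allL.
have iL := graph_path_induced esym acyc Lp.
exists (fun i => nth v0 L i); split.
  apply: inj_card_bij; last by rewrite card_ord.
  move=> i j /eqP; rewrite nth_uniq ?szL // => /eqP ij; exact: val_inj.
move=> i j /=; have [lt|lt|ij] := ltngtP i j.
- have ltL : i < j < size L by rewrite lt szL ltn_ord.
  rewrite (induced_path_nth v0 uL iL ltL) [j.+1 == i]gtn_eqF ?orbF //.
  by rewrite ltnS ltnW.
- have ltL : j < i < size L by rewrite lt szL ltn_ord.
  rewrite esym (induced_path_nth v0 uL iL ltL) [i.+1 == j]gtn_eqF //.
  by rewrite ltnS ltnW.
by rewrite (ord_inj ij) eirr !gtn_eqF.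
Qed.

Local Open Scope ring_scope.

Theorem theorem3p10 (V : finType) (e : rel V) (treeT : is_tree e)
    (not_path : ~ is_path_graph e) :
  exists e' : rel V,
    standard_1_associate e e' /\ mean_subtree_order e > mean_subtree_order e'.
Proof.
have [simple conn acyc] := treeT.
have [/existsP[v0 deg0]|/existsPn low] := boolP [exists v, (2 < deg e v)%N]; last first.
  by case: not_path; apply: path_graph_of_low_degree => // z; rewrite leqNgt low.
have [v [a [b [s [t [degv ab pa pb lowa]]]]]] := exists_fork simple acyc deg0.
exists (move_edge e v b (last a s)); split.
  exact: fork_standard_associate pa pb ab degv lowa.
exact: fork_mean_lt pa pb ab degv.
Qed.
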